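(* Let $\sigma^2>0$, $G_i>0$, $\eta_i>0$, $\eta_j>0$, $\zeta_i>0$, $\zeta_j>0$ and $D_i>0$ be real numbers, and put $g_i=\eta_iG_i$ and $g_j=\eta_jG_i$. Consider the optimization problem $$\min_{D_i^{(R)},\,D_i^{(S)}}\ \ \zeta_j\frac{\sigma^2}{g_j}\left(2^{D_i^{(R)}}-1\right)+\zeta_i\frac{\sigma^2}{g_i}\left(2^{D_i^{(S)}}-1\right)\quad\text{subject to}\quad D_i^{(R)}+D_i^{(S)}=D_i,\ \ 0\le D_i^{(R)}\le D_i .$$ Let $\theta_i=\zeta_i/\eta_i$ and $\theta_j=\zeta_j/\eta_j$. Then the optimal value of the variable $D_i^{(R)}$ in this problem is $$\hat D_i^{(R)}=\begin{cases}0, & \text{if } \log_2\frac{\theta_i}{\theta_j}<-D_i,\\[2pt] \frac12\left(D_i+\log_2\frac{\theta_i}{\theta_j}\right), & \text{if } -D_i\le \log_2\frac{\theta_i}{\theta_j}<D_i,\\[2pt] D_i, & \text{if } \log_2\frac{\theta_i}{\theta_j}\ge D_i.\end{cases}$$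
   Context: Interpretation: a source mobile terminal $i$ must deliver data at rate $D_i$ to a base station. It transmits the part $D_i^{(S)}$ directly, and a helping terminal $j$ relays the part $D_i^{(R)}$. Both terminals have the same path loss $G_i$ to the base station, and their fading powers are $\eta_i,\eta_j$, so their channel power gains are $g_i=\eta_iG_i$ and $g_j=\eta_jG_i$. The noise power is $\sigma^2$. Sending at rate $D$ over a channel with power gain $g$ costs energy $\frac{\sigma^2}{g}(2^D-1)$. The numbers $\zeta_i,\zeta_j$ are the unit energy costs of the two terminals, and $\theta_i,\theta_j$ are called their effective energy costs. The objective is the sum of the two terminals' energy costs. *)

(* Defs.v *)
From Stdlib Require Import Reals.
Open Scope R_scope.

Definition tx_energy (sigma g D : R) : R := sigma ^ 2 / g * (Rpower 2 D - 1).

Definition total_cost (sigma zetai zetaj gi gj DR DS : R) : R :=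
  zetaj * tx_energy sigma gj DR + zetai * tx_energy sigma gi DS.

Definition feasible (Di DR DS : R) : Prop := DR + DS = Di /\ 0 <= DR <= Di.

Definition optimal_split (sigma zetai zetaj gi gj Di DR DS : R) : Prop :=
  feasible Di DR DS /\
  forall DR' DS' : R, feasible Di DR' DS' ->
    total_cost sigma zetai zetaj gi gj DR DS
      <= total_cost sigma zetai zetaj gi gj DR' DS'.

Definition DR_hat (thetai thetaj Di : R) : R :=
  if Rlt_dec (Rlog 2 (thetai / thetaj)) (- Di) then 0
  else if Rlt_dec (Rlog 2 (thetai / thetaj)) Di
       then 1 / 2 * (Di + Rlog 2 (thetai / thetaj))
       else Di.

(* Main.v *)
(** Writing [L = log2 (thetai / thetaj)] and [m = (Di + L) / 2], on the
    constraint set the cost is, up to an additive constant, a positive multiple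
    of [2^(DR - m) + 2^(m - DR)]. This is strictly increasing in [|DR - m|], so
    the unique minimizer is the point of [[0, Di]] closest to [m]. *)

Require Import Defs.
From Stdlib Require Import Reals Lra.
Open Scope R_scope.

Lemma Rpower_plus_opp_lt (a u v : R) : 1 < a -> Rabs u < Rabs v ->
  Rpower a u + Rpower a (- u) < Rpower a v + Rpower a (- v).
Proof.
  intros Ha Huv.
  (* The difference of the two sides is [(a^v - a^u) (1 - a^(-u-v))]. *)
  assert (Hfact : 0 < (Rpower a v - Rpower a u) * (1 - Rpower a (- u + - v))).
  { assert (H0 : Rpower a 0 = 1) by (apply Rpower_O; lra).
    rewrite <- H0.
    (* Since [Rabs u < Rabs v], both [v - u] and [u + v] have the sign of [v], so the two factors
       are both positive or both negative. *)
    destruct (Rle_or_lt 0 v) as [Hv | Hv].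
    - rewrite (Rabs_right v) in Huv by lra.
      apply Rabs_def2 in Huv.
      apply Rmult_lt_0_compat; apply Rlt_0_minus; apply Rpower_lt; lra.
    - rewrite (Rabs_left v) in Huv by lra.
      apply Rabs_def2 in Huv.
      assert (Rpower a v < Rpower a u) by (apply Rpower_lt; lra).
      assert (Rpower a 0 < Rpower a (- u + - v)) by (apply Rpower_lt; lra).
      nra. }
  assert (Hinv : forall w, Rpower a w * Rpower a (- w) = 1).
  { intros w. rewrite <- Rpower_plus, Rplus_opp_r. apply Rpower_O; lra. }
  rewrite Rpower_plus in Hfact.
  replace ((Rpower a v - Rpower a u) * (1 - Rpower a (- u) * Rpower a (- v)))
    with (Rpower a v - Rpower a u
          - (Rpower a v * Rpower a (- v)) * Rpower a (- u)
          + (Rpower a u * Rpower a (- u)) * Rpower a (- v)) in Hfact by ring.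
  rewrite (Hinv u), (Hinv v) in Hfact.
  lra.
Qed.

Lemma Rpower_Rlog (a x : R) : 1 < a -> 0 < x -> Rpower a (Rlog a x) = x.
Proof.
  intros Ha Hx. unfold Rpower, Rlog.
  assert (0 < ln a) by (rewrite <- ln_1; apply ln_increasing; lra).
  replace (ln x / ln a * ln a) with (ln x) by (field; lra).
  now apply exp_ln.
Qed.

(** The common path loss turns the two weights into [thetaj / G] and [thetai / G]. The centre [m] is
    where the two exponential terms balance, [thetaj * 2^m = thetai * 2^(D - m)], so both share one
    coefficient. *)
Lemma total_cost_centered (sigma G etai etaj zetai zetaj D x : R) :
  0 < G -> 0 < etai -> 0 < etaj -> 0 < zetai -> 0 < zetaj ->
  let thetai := zetai / etai in
  let thetaj := zetaj / etaj in
  let m := (D + Rlog 2 (thetai / thetaj)) / 2 in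
  total_cost sigma zetai zetaj (etai * G) (etaj * G) x (D - x)
  = sigma ^ 2 / G * thetaj * Rpower 2 m
      * (Rpower 2 (x - m) + Rpower 2 (- (x - m)))
    - sigma ^ 2 / G * (thetai + thetaj).
Proof.
  intros HG Hetai Hetaj Hzetai Hzetaj thetai thetaj m.
  assert (Hi : 0 < thetai) by now apply Rdiv_lt_0_compat.
  assert (Hj : 0 < thetaj) by now apply Rdiv_lt_0_compat.
  assert (Hx : Rpower 2 m * Rpower 2 (x - m) = Rpower 2 x).
  { rewrite <- Rpower_plus. f_equal. ring. }
  assert (Hy : thetaj * (Rpower 2 m * Rpower 2 (- (x - m)))
               = thetai * Rpower 2 (D - x)).
  { rewrite <- Rpower_plus.
    (* As [2 * m - D] is the logarithm of [thetai / thetaj], its power of 2 trades [thetaj] for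
       [thetai]. *)
    replace (m + - (x - m)) with (Rlog 2 (thetai / thetaj) + (D - x))
      by (unfold m; field).
    rewrite Rpower_plus, Rpower_Rlog;
      [field; lra | lra | now apply Rdiv_lt_0_compat]. }
  transitivity (sigma ^ 2 / G * (thetaj * (Rpower 2 m * Rpower 2 (x - m))
    + thetaj * (Rpower 2 m * Rpower 2 (- (x - m))))
    - sigma ^ 2 / G * (thetai + thetaj)); [| ring].
  rewrite Hx, Hy. unfold total_cost, tx_energy, thetai, thetaj.
  field. lra.
Qed.

Lemma DR_hat_bounds (thetai thetaj D : R) :
  0 < D -> 0 <= DR_hat thetai thetaj D <= D.
Proof.
  intros HD. unfold DR_hat.
  destruct (Rlt_dec _ (- D)); [lra |]. destruct (Rlt_dec _ D); lra.
Qed.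

(** The three branches are [m < 0], [0 <= m < D] and [m >= D]: [DR_hat] is [m] clamped to the
    interval from 0 to [D]. *)
Lemma DR_hat_closest (thetai thetaj D x : R) :
  0 <= x <= D -> x <> DR_hat thetai thetaj D ->
  let m := (D + Rlog 2 (thetai / thetaj)) / 2 in
  Rabs (DR_hat thetai thetaj D - m) < Rabs (x - m).
Proof.
  unfold DR_hat. intros Hx.
  destruct (Rlt_dec _ (- D)); [| destruct (Rlt_dec _ D)]; intros Hne;
    unfold Rabs; repeat destruct Rcase_abs; lra.
Qed.

(** Strictness makes this serve both directions of the theorem, optimality and uniqueness. *)
Lemma total_cost_DR_hat_lt (sigma G etai etaj zetai zetaj D x : R) :
  0 < sigma ^ 2 -> 0 < G ->
  0 < etai -> 0 < etaj -> 0 < zetai -> 0 < zetaj -> 0 <= x <= D ->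
  let xh := DR_hat (zetai / etai) (zetaj / etaj) D in
  x <> xh ->
  total_cost sigma zetai zetaj (etai * G) (etaj * G) xh (D - xh)
  < total_cost sigma zetai zetaj (etai * G) (etaj * G) x (D - x).
Proof.
  intros Hs HG Hetai Hetaj Hzetai Hzetaj Hx xh Hne.
  rewrite !total_cost_centered by assumption.
  apply Rplus_lt_compat_r, Rmult_lt_compat_l.
  - apply Rmult_lt_0_compat; [| apply exp_pos].
    apply Rmult_lt_0_compat; now apply Rdiv_lt_0_compat.
  - apply Rpower_plus_opp_lt; [lra |]. now apply DR_hat_closest.
Qed.

(* "The optimal value is DR_hat": DR is the relayed part of some optimal
   solution exactly when it is DR_hat (existence and uniqueness). *)
Theorem proposition3p1
  (sigma Gi etai etaj zetai zetaj Di : R)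
  (hsigma : 0 < sigma ^ 2) (hGi : 0 < Gi)
  (hetai : 0 < etai) (hetaj : 0 < etaj)
  (hzetai : 0 < zetai) (hzetaj : 0 < zetaj) (hDi : 0 < Di) :
  let gi := etai * Gi in
  let gj := etaj * Gi in
  let thetai := zetai / etai in
  let thetaj := zetaj / etaj in
  forall DR : R,
    (exists DS : R, optimal_split sigma zetai zetaj gi gj Di DR DS)
    <-> DR = DR_hat thetai thetaj Di.
Proof.
  intros gi gj thetai thetaj DR.
  set (xh := DR_hat thetai thetaj Di).
  assert (Hxh : 0 <= xh <= Di) by now apply DR_hat_bounds.
  split.
  - intros [DS [[Hsum Hbd] Hopt]].
    destruct (Req_dec DR xh) as [| Hne]; [assumption | exfalso].
    (* An optimal [DR] other than [xh] would be strictly beaten by the feasible split at [xh]. *)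
    assert (Hle := Hopt xh (Di - xh) (conj (Rplus_minus _ _) Hxh)).
    replace DS with (Di - DR) in Hle by lra.
    apply (Rle_not_lt _ _ Hle).
    now apply total_cost_DR_hat_lt.
  - intros ->. exists (Di - xh). split.
    + split; [ring | exact Hxh].
    + intros x y [Hsum Hbd]. replace y with (Di - x) by lra.
      destruct (Req_dec x xh) as [-> | Hne]; [apply Rle_refl |].
      left. now apply total_cost_DR_hat_lt.
Qed.
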